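(* For every capsule $\langle M,e\rangle$ there exists a tree process $T_{\langle M,e\rangle}$ such that for all $\alpha\in 2^\omega$ and all reduced capsules $\langle v,f\rangle$, $$\langle M,e\rangle\Downarrow_\alpha\langle v,f\rangle\iff\langle M,e\rangle\to_{T_{\langle M,e\rangle}(\alpha)}\langle v,f\rangle.$$
   Context: Syntax: terms $M::=x\mid\lambda x.M\mid MN\mid M\oplus N$ over a countable set $\mathrm{Var}$; $\Lambda$ is the set of $\lambda$-abstractions; $\mathrm{FV}$ denotes free variables; $M[y/x]$ is renaming. A capsule is a pair $\langle M,e\rangle$ with $e:\mathrm{Var}\rightharpoonup\Lambda$ a finite partial function such that $\mathrm{FV}(M)\subseteq\mathrm{dom}\,e$ and $\mathrm{FV}(e(x))\subseteq\mathrm{dom}\,e$ for $x\in\mathrm{dom}\,e$; capsules are identified modulo $\alpha$-conversion (including variables in $\mathrm{dom}\,e$) and removal of unreachable bindings. A capsule is reduced if its first component is in $\Lambda$; $e[v/y]$ is rebinding. Coins: $2^\omega$ infinite binary sequences; $\pi_i(\alpha)=\alpha_i\alpha_{i+3}\alpha_{i+6}\cdots$ ($i=0,1,2$); $x\prec\alpha$ means the finite string $x$ is a prefix of $\alpha$. Big-step: least relation with $\langle x,e\rangle\Downarrow_\alpha\langle e(x),e\rangle$; $\langle\lambda x.M,e\rangle\Downarrow_\alpha\langle\lambda x.M,e\rangle$; if $\langle M,e\rangle\Downarrow_\alpha\langle v,f\rangle$ then $\langle M\oplus N,e\rangle\Downarrow_{0\alpha}\langle v,f\rangle$; if $\langle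 N,e\rangle\Downarrow_\alpha\langle v,f\rangle$ then $\langle M\oplus N,e\rangle\Downarrow_{1\alpha}\langle v,f\rangle$; if $\langle M,e\rangle\Downarrow_{\pi_0(\alpha)}\langle\lambda x.K,e_0\rangle$, $\langle N,e_0\rangle\Downarrow_{\pi_1(\alpha)}\langle u,e_1\rangle$ and $\langle K[y/x],e_1[u/y]\rangle\Downarrow_{\pi_2(\alpha)}\langle v,f\rangle$ ($y$ fresh), then $\langle MN,e\rangle\Downarrow_\alpha\langle v,f\rangle$. Small-step: $\langle M,e\rangle\to_x\langle N,f\rangle$ for $x\in2^*$ is the least relation with: if $\langle M,e\rangle\to_x\langle M',f\rangle$ then $\langle MN,e\rangle\to_x\langle M'N,f\rangle$; if $\langle N,e\rangle\to_x\langle N',f\rangle$ and $v\in\Lambda$ then $\langle vN,e\rangle\to_x\langle vN',f\rangle$; $\langle M,e\rangle\to_\varepsilon\langle M,e\rangle$; $\langle x,e\rangle\to_\varepsilon\langle e(x),e\rangle$; $\langle(\lambda x.M)v,e\rangle\to_\varepsilon\langle M[y/x],e[v/y]\rangle$ for $v\in\Lambda$, $y$ fresh; $\langle M\oplus N,e\rangle\to_0\langle M,e\rangle$; $\langle M\oplus N,e\rangle\to_1\langle N,e\rangle$; if $\langle M,e\rangle\to_x\langle N,f\rangle$ and $\langle N,f\rangle\to_y\langle K,g\rangle$ then $\langle M,e\rangle\to_{xy}\langle K,g\rangle$. For $\beta\in2^\omega$, $\langle M,e\rangle\to_\beta\langle N,f\rangle$ means $\langle M,e\rangle\to_x\langle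 N,f\rangle$ for some finite $x\prec\beta$. Tree processes: given $t:2^*\to\mathbb N$ with $t(x)\neq t(y)$ whenever $x$ is a proper prefix of $y$, the associated tree process $T:2^\omega\to2^\omega$ maps $\alpha$ to $\beta=\beta_0\beta_1\cdots$ where $\beta_n=\alpha_{t(\beta_0\cdots\beta_{n-1})}$. *)

(* Defs.v *)
From Stdlib Require Import Relation_Operators.
From mathcomp Require Import all_boot finmap.

Set Implicit Arguments.
Unset Strict Implicit.
Unset Printing Implicit Defensive.

Local Open Scope fset_scope.
Local Open Scope fmap_scope.

(* Named syntax over the countable set nat of variables.  Raw terms are not
   identified up to alpha; this is done by [capsule_eq] below. *)
Inductive term : Type :=
| Var of nat
| Lam of nat & term
| App of term & term
| Oplus of term & term.

Definition is_lam (M : term) : bool := if M is Lam _ _ then true else false.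

Fixpoint fv (M : term) : {fset nat} :=
  match M with
  | Var x => [fset x]
  | Lam x M => fv M `\ x
  | App M N => fv M `|` fv N
  | Oplus M N => fv M `|` fv N
  end.

(* All variables that occur: free, bound or binding. *)
Fixpoint vars (M : term) : {fset nat} :=
  match M with
  | Var x => [fset x]
  | Lam x M => x |` vars M
  | App M N => vars M `|` vars N
  | Oplus M N => vars M `|` vars N
  end.

(* [rename y x M] is M[y/x]: free occurrences of x become y.  It may capture y,
   and is therefore only used when y is not in [vars M]. *)
Fixpoint rename (y x : nat) (M : term) : term :=
  match M with
  | Var z => Var (if z == x then y else z)
  | Lam z M => Lam z (if z == x then M else rename y x M)
  | App M N => App (rename y x M) (rename y x N)
  | Oplus M N => Oplus (rename y x M) (rename y x N)
  end.

Definition env : Type := {fmap nat -> term}.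

Definition is_capsule (M : term) (e : env) : bool :=
  (fv M `<=` domf e) &&
  [forall z : domf e, is_lam (e z) && (fv (e z) `<=` domf e)].

(* Representatives of capsules; the identification is [capsule_eq]. *)
Record capsule : Type := Capsule {
  cterm : term;
  cenv : env;
  capsuleP : is_capsule cterm cenv }.

Definition reduced (c : capsule) : bool := is_lam (cterm c).

Definition fresh (y : nat) (M : term) (e : env) : bool :=
  [&& y \notin vars M, y \notin domf e
    & [forall z : domf e, y \notin vars (e z)]].

(* Change of one bound variable, anywhere in the term. *)
Inductive alpha_step : term -> term -> Prop :=
| alpha_here x y M :
    y \notin vars M -> alpha_step (Lam x M) (Lam y (rename y x M))
| alpha_lam x M M' : alpha_step M M' -> alpha_step (Lam x M) (Lam x M')
| alpha_appl M M' N : alpha_step M M' -> alpha_step (App M N) (App M' N)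
| alpha_appr M N N' : alpha_step N N' -> alpha_step (App M N) (App M N')
| alpha_oplusl M M' N : alpha_step M M' -> alpha_step (Oplus M N) (Oplus M' N)
| alpha_oplusr M N N' : alpha_step N N' -> alpha_step (Oplus M N) (Oplus M N').

Inductive reachable (M : term) (e : env) : nat -> Prop :=
| reach_term x : x \in fv M -> reachable M e x
| reach_env (x y : nat) (v : term) :
    reachable M e y -> e.[? y] = Some v -> x \in fv v -> reachable M e x.

Definition rename_env (y x : nat) (e : env) : env :=
  [fmap z : domf e => rename y x (e z)].

Inductive conv_step : term -> env -> term -> env -> Prop :=
| conv_term M M' (e : env) : alpha_step M M' -> conv_step M e M' e
| conv_env M (e : env) (x : nat) v v' :
    e.[? x] = Some v -> alpha_step v v' -> conv_step M e M e.[x <- v']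
| conv_dom M (e : env) (x y : nat) v :
    e.[? x] = Some v -> fresh y M e ->
    conv_step M e (rename y x M)
      (rename_env y x e).[~ x].[y <- rename y x v]
| conv_gc M (e : env) (S : {fset nat}) :
    (forall z : nat, z \in S -> ~ reachable M e z) -> conv_step M e M e.[\ S].

(* Every intermediate pair is a capsule, since the closure is taken on the type
   [capsule]. *)
Definition capsule_eq : capsule -> capsule -> Prop :=
  clos_refl_sym_trans capsule
    (fun c d => conv_step (cterm c) (cenv c) (cterm d) (cenv d)).

Definition coins : Type := nat -> bool.

Definition proj (i : nat) (a : coins) : coins := fun n => a (i + 3 * n)%N.

Definition tail (a : coins) : coins := fun n => a n.+1.

(* The evaluation rules are stated on representatives, because they thread the
   environment: in a premise about <M, e> used for M N, the bindings of e that
   only N reaches must be kept, under the same names. *)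
Inductive big_raw : coins -> term -> env -> term -> env -> Prop :=
| big_var a (x : nat) (e : env) v : e.[? x] = Some v -> big_raw a (Var x) e v e
| big_lam a x M e : big_raw a (Lam x M) e (Lam x M) e
| big_oplus0 a M N e v f :
    a 0 = false -> big_raw (tail a) M e v f -> big_raw a (Oplus M N) e v f
| big_oplus1 a M N e v f :
    a 0 = true -> big_raw (tail a) N e v f -> big_raw a (Oplus M N) e v f
| big_app a M N (e : env) x K (e0 : env) u (e1 : env) y v (f : env) :
    big_raw (proj 0 a) M e (Lam x K) e0 ->
    big_raw (proj 1 a) N e0 u e1 ->
    fresh y (App (Lam x K) u) e1 ->
    big_raw (proj 2 a) (rename y x K) e1.[y <- u] v f ->
    big_raw a (App M N) e v f.

Inductive small_raw : seq bool -> term -> env -> term -> env -> Prop :=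
| small_appl x M N e M' f :
    small_raw x M e M' f -> small_raw x (App M N) e (App M' N) f
| small_appr x v N e N' f :
    is_lam v -> small_raw x N e N' f -> small_raw x (App v N) e (App v N') f
| small_refl M e : small_raw [::] M e M e
| small_var (z : nat) (e : env) v : e.[? z] = Some v -> small_raw [::] (Var z) e v e
| small_beta z M v (e : env) y :
    is_lam v -> fresh y (App (Lam z M) v) e ->
    small_raw [::] (App (Lam z M) v) e (rename y z M) e.[y <- v]
| small_oplus0 M N e : small_raw [:: false] (Oplus M N) e M e
| small_oplus1 M N e : small_raw [:: true] (Oplus M N) e N e
| small_trans x y M e N f K g :
    small_raw x M e N f -> small_raw y N f K g -> small_raw (x ++ y) M e K g.

(* The relations on identified capsules. *)
Definition big (a : coins) (c d : capsule) : Prop :=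
  exists c' d' : capsule,
    [/\ capsule_eq c c',
        big_raw a (cterm c') (cenv c') (cterm d') (cenv d')
      & capsule_eq d' d].

Definition small (x : seq bool) (c d : capsule) : Prop :=
  exists c' d' : capsule,
    [/\ capsule_eq c c',
        small_raw x (cterm c') (cenv c') (cterm d') (cenv d')
      & capsule_eq d' d].

Definition finite_prefix (x : seq bool) (b : coins) : Prop :=
  x = mkseq b (size x).

Definition small_inf (b : coins) (c d : capsule) : Prop :=
  exists2 x : seq bool, finite_prefix x b & small x c d.

Definition coin_tree (t : seq bool -> nat) : Prop :=
  forall x y : seq bool, prefix x y -> x <> y -> t x <> t y.

(* [mkseq (T a) n] is the string of the first n bits of T a, so the equation
   determines T from t by recursion on n. *)
Definition tree_process (T : coins -> coins) : Prop :=
  exists2 t : seq bool -> nat, coin_tree t &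
    forall (a : coins) (n : nat), T a n = a (t (mkseq (T a) n)).

(* Main.v *)
Require Import Defs.
From Stdlib Require Import ClassicalEpsilon.
From mathcomp Require Import all_boot finmap.
From mathcomp Require Import zify.

(** An evaluation tosses finitely many coins, each read at a definite position
    of the stream, so it is described by the list of its tosses (position,
    outcome) in order of time.  A big step holds exactly for the streams that
    agree with such a list, and a small-step run consumes exactly the outcomes
    in that list.  Evaluation is deterministic up to the names of variables, so
    two evaluations of the same capsule can first differ only in the outcome of
    a toss at the same position.  The position of the next toss is therefore a
    function of the outcomes so far, and this function is the tree; on strings
    that no evaluation follows, any position not used before will do. *)

Set Implicit Arguments.
Unset Strict Implicit.
Unset Printing Implicit Defensive.

Local Open Scope fset_scope.
Local Open Scope fmap_scope.

(** * Evaluation with a record of the tosses *)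

Definition tosses : Type := seq (nat * bool).

Definition outcomes (l : tosses) : seq bool := [seq p.2 | p <- l].

Definition reindex (h : nat -> nat) (l : tosses) : tosses :=
  [seq (h p.1, p.2) | p <- l].

Definition agree (a : coins) (l : tosses) : bool := all (fun p => a p.1 == p.2) l.

(** The coin that [proj i a] has at [n] lies at [third i n] in [a]; reindexing by it moves the
    tosses of a premise of an application to their places in the whole stream. *)
Definition third (i n : nat) : nat := i + 3 * n.

(** The stream is left out and only the tosses made are recorded. Concatenation follows time, as
    small steps do, although the positions of the three premises interleave. *)
Inductive traced : term -> env -> term -> env -> tosses -> Prop :=
| traced_var (x : nat) (e : env) v :
    e.[? x] = Some v -> traced (Var x) e v e [::]
| traced_lam x M e : traced (Lam x M) e (Lam x M) e [::]
| traced_oplus0 M N e v f l :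
    traced M e v f l -> traced (Oplus M N) e v f ((0, false) :: reindex S l)
| traced_oplus1 M N e v f l :
    traced N e v f l -> traced (Oplus M N) e v f ((0, true) :: reindex S l)
| traced_app M N (e : env) x K (e0 : env) u (e1 : env) y v (f : env) l0 l1 l2 :
    traced M e (Lam x K) e0 l0 ->
    traced N e0 u e1 l1 ->
    fresh y (App (Lam x K) u) e1 ->
    traced (rename y x K) e1.[y <- u] v f l2 ->
    traced (App M N) e v f
      (reindex (third 0) l0 ++ reindex (third 1) l1 ++ reindex (third 2) l2).

Lemma outcomes_cat l l' : outcomes (l ++ l') = outcomes l ++ outcomes l'.
Proof. exact: map_cat. Qed.

Lemma outcomes_reindex h l : outcomes (reindex h l) = outcomes l.
Proof. by rewrite /outcomes -map_comp. Qed.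

Lemma agree_cat a l l' : agree a (l ++ l') = agree a l && agree a l'.
Proof. exact: all_cat. Qed.

Lemma agree_reindex a h l : agree a (reindex h l) = agree (a \o h) l.
Proof. exact: all_map. Qed.

Lemma big_raw_traced a M e v f :
  big_raw a M e v f <-> exists2 l, traced M e v f l & agree a l.
Proof.
split.
- elim=> {a M e v f}
    [a x e v ev|a x M e|a M N e v f a0 _ [l tl al]|a M N e v f a0 _ [l tl al]|
     a M N e x K e0 u e1 y v f _ [l0 t0 a0] _ [l1 t1 a1] fy _ [l2 t2 a2]].
  + by exists [::] => //; constructor.
  + by exists [::] => //; constructor.
  + exists ((0, false) :: reindex S l); first by constructor.
    by rewrite /= a0 agree_reindex.
  + exists ((0, true) :: reindex S l); first by constructor.
    by rewrite /= a0 agree_reindex.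
  + eexists; first exact: traced_app t0 t1 fy t2.
    by rewrite !agree_cat !agree_reindex a0 a1 a2.
- case=> l tl; elim: tl a => {M e v f l}
    [x e v ev|x M e|M N e v f l _ IH|M N e v f l _ IH|
     M N e x K e0 u e1 y v f l0 l1 l2 _ IH0 _ IH1 fy _ IH2] a.
  + by constructor.
  + by constructor.
  + by move=> /= /andP[/eqP a0]; rewrite agree_reindex => /IH; exact: big_oplus0.
  + by move=> /= /andP[/eqP a0]; rewrite agree_reindex => /IH; exact: big_oplus1.
  + rewrite !agree_cat !agree_reindex => /and3P[/IH0 b0 /IH1 b1 /IH2 b2].
    exact: big_app b0 b1 fy b2.
Qed.

(** Reindexing is injective, a tail never meets position 0, and the three projections use different
    residues modulo 3. The distinctness that [coin_tree] demands comes from here. *)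
Lemma traced_uniq M e v f l : traced M e v f l -> uniq [seq p.1 | p <- l].
Proof.
have fstE h l' : [seq p.1 | p <- reindex h l'] = map h [seq p.1 | p <- l'].
  by rewrite /reindex -!map_comp.
have third_inj i : injective (third i) by move=> m n; rewrite /third; lia.
have disj i j (s s' : seq nat) : (i < 3)%N -> (j < 3)%N -> i != j ->
    ~~ has (mem (map (third i) s)) (map (third j) s').
  move=> i3 j3 ij; apply/hasPn => _ /mapP[m _ ->] /=.
  by apply/mapP => -[n _]; rewrite /third; lia.
elim=> {M e v f l} [//|//|M N e v f l _ IH|M N e v f l _ IH|
  M N e x K e0 u e1 y v f l0 l1 l2 _ IH0 _ IH1 _ _ IH2].
- rewrite /= fstE (map_inj_uniq succn_inj) IH andbT.
  by apply/mapP => -[].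
- rewrite /= fstE (map_inj_uniq succn_inj) IH andbT.
  by apply/mapP => -[].
- rewrite !map_cat !fstE !cat_uniq !(map_inj_uniq (@third_inj _)) IH0 IH1 IH2.
  by rewrite has_cat negb_or !disj.
Qed.

(** * Traces and small steps *)

(** This part of the capsule condition is enough to compare traces with small-step runs: what a
    variable is bound to is a value and makes no tosses. *)
Definition lam_env (e : env) : Prop :=
  forall (x : nat) v, e.[? x] = Some v -> is_lam v.

Lemma lam_env_set (e : env) (y : nat) u :
  lam_env e -> is_lam u -> lam_env e.[y <- u].
Proof. by move=> le lu x v; rewrite fnd_set; case: eqP => _; [case=> <-|exact: le]. Qed.

Lemma capsule_lam_env (c : capsule) : lam_env (cenv c).
Proof.
case: c => M e /= /andP[_ /forallP ce] x v.
by case: fndP => // xe [<-]; case/andP: (ce [` xe]).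
Qed.

Lemma traced_lam_env M e v f l : traced M e v f l -> lam_env e -> is_lam v /\ lam_env f.
Proof.
elim=> {M e v f l} [x e v ev|||M N e v f l _ IH|
  M N e x K e0 u e1 y v f l0 l1 l2 _ IH0 _ IH1 _ _ IH2] //.
- by move=> le; split; first exact: le ev.
- move=> /IH0[_ le0]; have [lu le1] := IH1 le0.
  exact/IH2/lam_env_set.
Qed.

Lemma small_lam_env x M e N f : small_raw x M e N f -> lam_env e -> lam_env f.
Proof.
by elim=> {x M e N f} //; [move=> *; exact: lam_env_set|move=> *; auto].
Qed.

Lemma traced_small M e v f l :
  traced M e v f l -> lam_env e -> small_raw (outcomes l) M e v f.
Proof.
elim=> {M e v f l} [x e v ev|x M e|M N e v f l _ IH|M N e v f l _ IH|
  M N e x K e0 u e1 y v f l0 l1 l2 t0 IH0 t1 IH1 fy _ IH2] le.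
- exact: small_var.
- exact: small_refl.
- by rewrite /= outcomes_reindex; apply: small_trans (small_oplus0 _ _ _) (IH le).
- by rewrite /= outcomes_reindex; apply: small_trans (small_oplus1 _ _ _) (IH le).
- have [_ le0] := traced_lam_env t0 le; have [lu le1] := traced_lam_env t1 le0.
  rewrite !outcomes_cat !outcomes_reindex.
  apply: small_trans (small_appl _ (IH0 le)) _.
  apply: small_trans (small_appr (isT : is_lam (Lam x K)) (IH1 le0)) _.
  exact: small_trans (small_beta lu fy) (IH2 (lam_env_set le1 lu)).
Qed.

Lemma traced_value v e : is_lam v -> traced v e v e [::].
Proof. by case: v => // x M _; constructor. Qed.

Lemma traced_valueE v e w f l :
  is_lam v -> traced v e w f l -> [/\ w = v, f = e & l = [::]].
Proof. by case: v => // x M _ H; inversion H. Qed.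

(** Expansion backwards along a run: a step inside an application changes only the matching premise
    of its trace, found by inversion. No run of an application has to be cut into its three
    phases. *)
Lemma traced_expand x M e N f v g l :
  small_raw x M e N f -> lam_env e -> traced N f v g l ->
  exists2 l', traced M e v g l' & outcomes l' = x ++ outcomes l.
Proof.
move=> s; elim: s v g l => {x M e N f}
  [x M N e M' f _ IH|x w N e N' f lw _ IH|M e|z e w ew|
   z M w e y lw fy|M N e|M N e|x y M e N f K g sx IHx _ IHy] v' g' l le tl.
- inversion tl as [| | | |? ? ? ? ? ? ? ? ? ? ? l0 l1 l2 t0 t1 fy t2]; subst.
  have [l0' t0' o0] := IH _ _ _ le t0.
  eexists; first exact: traced_app t0' t1 fy t2.
  by rewrite !outcomes_cat !outcomes_reindex o0 !catA.
- inversion tl as [| | | |? ? ? ? ? ? ? ? ? ? ? l0 l1 l2 t0 t1 fy t2]; subst.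
  have [wE fE l0E] := traced_valueE lw t0; subst.
  have [l1' t1' o1] := IH _ _ _ le t1.
  eexists; first exact: traced_app (traced_lam _ _ _) t1' fy t2.
  by rewrite !outcomes_cat !outcomes_reindex o1 /= !catA.
- by exists l.
- have [-> -> ->] := traced_valueE (le _ _ ew) tl.
  by exists [::] => //; constructor.
- eexists; first exact: traced_app (traced_lam _ _ _) (traced_value _ lw) fy tl.
  by rewrite !outcomes_cat !outcomes_reindex.
- by eexists; [apply: traced_oplus0 tl|rewrite /= outcomes_reindex].
- by eexists; [apply: traced_oplus1 tl|rewrite /= outcomes_reindex].
- have [l1 t1 o1] := IHy _ _ _ (small_lam_env sx le) tl.
  have [l2 t2 o2] := IHx _ _ _ le t1.
  by exists l2; rewrite // o2 o1 catA.
Qed.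

Lemma small_traced x M e v f :
  small_raw x M e v f -> lam_env e -> is_lam v ->
  exists2 l, traced M e v f l & outcomes l = x.
Proof.
move=> s le lv; have [l tl ol] := traced_expand s le (traced_value f lv).
by exists l; rewrite // ol cats0.
Qed.

(** * Bisimilar capsules *)

(** Pairs with a shadowed name are dropped, so that a bound name can match only its partner; with
    this, [aeq] is alpha-equivalence relative to a matching [R] of the free names. *)
Definition extend (R : nat -> nat -> Prop) (x x' y y' : nat) : Prop :=
  (y = x /\ y' = x') \/ [/\ y <> x, y' <> x' & R y y'].

Fixpoint aeq (R : nat -> nat -> Prop) (M M' : term) : Prop :=
  match M, M' with
  | Var x, Var x' => R x x'
  | Lam x K, Lam x' K' => aeq (extend R x x') K K'
  | App K N, App K' N' => aeq R K K' /\ aeq R N N'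
  | Oplus K N, Oplus K' N' => aeq R K K' /\ aeq R N N'
  | _, _ => False
  end.

(** The condition makes [R] a bisimulation: following bindings never leaves [R]. Names outside [R]
    are unconstrained, which accommodates unreachable bindings. *)
Definition env_bisim (R : nat -> nat -> Prop) (e e' : env) : Prop :=
  forall x x', R x x' -> exists v v',
    [/\ e.[? x] = Some v, e'.[? x'] = Some v' & aeq R v v'].

(* Bisimilar capsules have the same possibly infinite unfolding.  This is coarser
   than [capsule_eq], but it already determines the tosses. *)
Definition bisim (M : term) (e : env) (M' : term) (e' : env) : Prop :=
  exists2 R, env_bisim R e e' & aeq R M M'.

Lemma aeq_mono (R R' : nat -> nat -> Prop) M M' :
  (forall x x', R x x' -> R' x x') -> aeq R M M' -> aeq R' M M'.
Proof.
elim: M M' R R' => [x|x M IH|M IHM N IHN|M IHM N IHN] [x'|x' M'|M' N'|M' N'] R R' RR' //=.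
- exact: RR'.
- by apply: IH => y y' [|[yx yx' /RR']]; [left|right].
- by case=> /(IHM _ _ _ RR') ? /(IHN _ _ _ RR').
- by case=> /(IHM _ _ _ RR') ? /(IHN _ _ _ RR').
Qed.

Lemma aeq_sym R M M' : aeq R M M' -> aeq (fun x x' => R x' x) M' M.
Proof.
elim: M M' R => [x|x M IH|M IHM N IHN|M IHM N IHN] [x'|x' M'|M' N'|M' N'] R //=.
- by move/IH; apply: aeq_mono => y y' [[-> ->]|[? ? ?]]; [left|right].
- by case=> /IHM ? /IHN.
- by case=> /IHM ? /IHN.
Qed.

Lemma aeq_trans R R' M M' M'' :
  aeq R M M' -> aeq R' M' M'' ->
  aeq (fun x x'' => exists2 x', R x x' & R' x' x'') M M''.
Proof.
elim: M M' M'' R R' => [x|x M IH|M IHM N IHN|M IHM N IHN]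
  [x'|x' M'|M' N'|M' N'] [x''|x'' M''|M'' N''|M'' N''] R R' //=.
- by exists x'.
- move=> /IH{}IH /IH; apply: aeq_mono => y y'' [y'].
  case=> [[-> ->]|[yx yx' Ry]] [[? ?]|[y'x' y'x'' R'y]] //; first by left.
  by right; split => //; exists y'.
- by case=> /IHM{}IHM /IHN{}IHN [/IHM ? /IHN].
- by case=> /IHM{}IHM /IHN{}IHN [/IHM ? /IHN].
Qed.

Lemma aeq_refl (R : nat -> nat -> Prop) M :
  (forall z, z \in fv M -> R z z) -> aeq R M M.
Proof.
elim: M R => [z|z M IH|M IHM N IHN|M IHM N IHN] R RM /=.
- by apply: RM; rewrite inE.
- apply: IH => w wM; have [->|/eqP wz] := eqVneq w z; first by left.
  by right; split=> //; apply: RM; rewrite !inE wM andbT; apply/eqP.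
- by split; [apply: IHM|apply: IHN] => z zM; apply: RM; rewrite inE zM ?orbT.
- by split; [apply: IHM|apply: IHN] => z zM; apply: RM; rewrite inE zM ?orbT.
Qed.

Lemma fv_vars M z : z \in fv M -> z \in vars M.
Proof.
elim: M => [x|x M IH|M IHM N IHN|M IHM N IHN] //=; rewrite !inE.
- by case/andP=> _ /IH ->; rewrite orbT.
- by case/orP=> [/IHM|/IHN] ->; rewrite ?orbT.
- by case/orP=> [/IHM|/IHN] ->; rewrite ?orbT.
Qed.

Lemma aeq_rename_id (R : nat -> nat -> Prop) x y M :
  y \notin vars M -> R x y -> (forall z, z \in fv M -> z <> x -> R z z) ->
  aeq R M (rename y x M).
Proof.
elim: M R => [z|z M IH|M IHM N IHN|M IHM N IHN] R /=.
- rewrite inE => _ Rxy RM; case: (eqVneq z x) => [->//|/eqP zx].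
  by apply: RM; rewrite ?inE.
- rewrite !inE negb_or => /andP[/eqP yz yM] Rxy RM.
  case: (eqVneq z x) => [zx|/eqP zx].
    apply: aeq_refl => w wM; have [->|/eqP wz] := eqVneq w z; first by left.
    right; split=> //; apply: RM; last by rewrite -zx.
    by rewrite !inE wM andbT; apply/eqP.
  apply: IH => //; first by right; split=> // xz; apply: zx.
  move=> w wM wx; have [->|/eqP wz] := eqVneq w z; first by left.
  by right; split=> //; apply: RM => //; rewrite !inE wM andbT; apply/eqP.
- rewrite inE negb_or => /andP[yM yN] Rxy RM.
  by split; [apply: IHM|apply: IHN] => // z zM; apply: RM; rewrite inE zM ?orbT.
- rewrite inE negb_or => /andP[yM yN] Rxy RM.
  by split; [apply: IHM|apply: IHN] => // z zM; apply: RM; rewrite inE zM ?orbT.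
Qed.

Lemma aeq_alpha_step (R : nat -> nat -> Prop) M M' :
  alpha_step M M' -> (forall z, z \in fv M -> R z z) -> aeq R M M'.
Proof.
move=> s; elim: s R => {M M'} [x y M yM|x M M' _ IH|M M' N _ IH|M N N' _ IH|
  M M' N _ IH|M N N' _ IH] R RM /=.
- apply: aeq_rename_id => //; first by left.
  move=> z zM zx; right; split=> //; last first.
    by apply: RM; rewrite !inE zM andbT; apply/eqP.
  by move=> zy; move: yM; rewrite -zy fv_vars.
- apply: IH => w wM; have [->|/eqP wx] := eqVneq w x; first by left.
  by right; split=> //; apply: RM; rewrite !inE wM andbT; apply/eqP.
- by split; [apply: IH|apply: aeq_refl] => z zM; apply: RM; rewrite inE zM ?orbT.
- by split; [apply: aeq_refl|apply: IH] => z zM; apply: RM; rewrite inE zM ?orbT.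
- by split; [apply: IH|apply: aeq_refl] => z zM; apply: RM; rewrite inE zM ?orbT.
- by split; [apply: aeq_refl|apply: IH] => z zM; apply: RM; rewrite inE zM ?orbT.
Qed.

Lemma aeq_rename_left (R R' : nat -> nat -> Prop) x y M M' :
  y \notin vars M ->
  (forall z z', R z z' -> R' (if z == x then y else z) z') ->
  aeq R M M' -> aeq R' (rename y x M) M'.
Proof.
elim: M M' R R' => [z|z M IH|M IHM N IHN|M IHM N IHN]
  [z'|z' M'|M' N'|M' N'] R R' //=.
- by move=> _ RR' /RR'.
- rewrite !inE negb_or => /andP[/eqP yz yM] RR'.
  case: (eqVneq z x) => [zx|/eqP zx].
    apply: aeq_mono => w w' [|[wz wz' /RR']]; first by left.
    by rewrite -zx; case: eqP => // _; right.
  apply: IH => // w w' [[-> ->]|[wz wz' /RR' Rw]].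
    by case: eqP => // _; left.
  by right; split=> //; case: eqP.
- by rewrite inE negb_or => /andP[yM yN] RR' [/(IHM _ _ _ yM RR') ? /(IHN _ _ _ yN RR')].
- by rewrite inE negb_or => /andP[yM yN] RR' [/(IHM _ _ _ yM RR') ? /(IHN _ _ _ yN RR')].
Qed.

(** Meant for beta reduction, where the two sides may choose different fresh names. Each side is
    renamed separately, the right one after exchanging the sides with [aeq_sym]. *)
Lemma aeq_rename (R R' : nat -> nat -> Prop) x y x' y' M M' :
  y \notin vars M -> y' \notin vars M' -> R' y y' ->
  (forall z z', R z z' -> R' z z') ->
  aeq (extend R x x') M M' -> aeq R' (rename y x M) (rename y' x' M').
Proof.
move=> yM yM' R'y RR' MM'.
(* [R1] matches names after the left renaming and before the right one. *)
pose R1 z z' := (z = y /\ z' = x') \/ (z' <> x' /\ R z z').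
have : aeq R1 (rename y x M) M'.
  apply: aeq_rename_left MM' => // z z' [[-> ->]|[zx zx' Rz]].
    by rewrite eqxx; left.
  by case: eqP => // _; right.
move=> /aeq_sym M1; apply: (aeq_sym (R := fun z' z => R' z z')).
apply: aeq_rename_left M1 => // z' z [[-> ->]|[zx' /RR' Rz]].
  by rewrite eqxx.
by case: eqP.
Qed.

Lemma capsule_fv_term (c : capsule) z : z \in fv (cterm c) -> z \in domf (cenv c).
Proof. by case: c => M e /= /andP[/fsubsetP Me _]; exact: Me. Qed.

Definition closed_env (e : env) : Prop :=
  forall (x : nat) v z, e.[? x] = Some v -> z \in fv v -> z \in domf e.

Lemma capsule_closed_env (c : capsule) : closed_env (cenv c).
Proof.
case: c => M e /= /andP[_ /forallP ce] x v z.
by case: fndP => // xe [<-]; case/andP: (ce [` xe]) => _ /fsubsetP; apply.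
Qed.

Lemma fnd_dom (e : env) (x : nat) v : e.[? x] = Some v -> x \in domf e.
Proof. by case: fndP. Qed.

Definition dom_id (e : env) (z z' : nat) : Prop := z = z' /\ z \in domf e.

Lemma env_bisim_id e : closed_env e -> env_bisim (dom_id e) e e.
Proof.
move=> ce x _ [<- xe]; exists e.[xe], e.[xe].
by split; rewrite ?in_fnd //; apply: aeq_refl => z /(ce _ _ _ (in_fnd xe)).
Qed.

Lemma bisim_refl (c : capsule) : bisim (cterm c) (cenv c) (cterm c) (cenv c).
Proof.
exists (dom_id (cenv c)); first exact/env_bisim_id/capsule_closed_env.
by apply: aeq_refl => z /capsule_fv_term.
Qed.

Lemma bisim_sym M e M' e' : bisim M e M' e' -> bisim M' e' M e.
Proof.
case=> R ee' MM'; exists (fun x x' => R x' x); last exact: aeq_sym.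
by move=> x x' /ee'[v [v' [ev ev' /aeq_sym vv']]]; exists v', v.
Qed.

Lemma bisim_trans M e M' e' M'' e'' :
  bisim M e M' e' -> bisim M' e' M'' e'' -> bisim M e M'' e''.
Proof.
case=> R ee' MM' [R' ee'' MM'']; eexists; last exact: aeq_trans MM' MM''.
move=> x x'' [x' /ee'[v [v' [ev ev' vv']]] /ee''[w [w' [ew ew' ww']]]].
exists v, w'; split=> //; move: ew; rewrite ev' => -[v'w].
by apply: aeq_trans vv' _; rewrite v'w.
Qed.

(** The relation is the identity on the domain for a change of bound variable, the graph of the
    renaming for a change of name in the domain, and the identity on reachable names for a removal
    of bindings. *)
Lemma conv_step_bisim (c d : capsule) :
  conv_step (cterm c) (cenv c) (cterm d) (cenv d) ->
  bisim (cterm c) (cenv c) (cterm d) (cenv d).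
Proof.
have := capsule_closed_env (c := c); have := capsule_fv_term (c := c).
move: (cterm c) (cenv c) (cterm d) (cenv d) => M e M' e'' fvM fve s.
case: s fvM fve => {M e M' e''}
  [M M' e MM'|M e x v v' xv vv'|M e x y v xv fy|M e S Sr] fvM fve.
- exists (dom_id e); first exact: env_bisim_id.
  by apply: aeq_alpha_step => // z /fvM.
- exists (dom_id e); last by apply: aeq_refl => z /fvM.
  move=> z z' zz'; have [w [w' [zw z'w' ww']]] := env_bisim_id fve zz'.
  case: zz' z'w' => <- ze z'w'; rewrite fnd_set; case: eqP => [zx|_]; last by exists w, w'.
  exists v, v'; split; rewrite ?zx //.
  by apply: aeq_alpha_step => // u /(fve _ _ _ xv).
- case/and3P: fy => yM ye /forallP yv.
  have xe := fnd_dom xv.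
  pose R z z' := z \in domf e /\ z' = if z == x then y else z.
  have RR N : y \notin vars N -> (forall z, z \in fv N -> z \in domf e) ->
      aeq R N (rename y x N).
    move=> yN Ne; apply: aeq_rename_id => //; first by rewrite /R eqxx.
    by move=> z /Ne ze zx; split=> //; case: eqP.
  exists R; last exact: RR.
  move=> z _ [ze ->]; exists e.[ze], (rename y x e.[ze]); rewrite in_fnd; split=> //.
    case: (eqVneq z x) => [zx|zx].
      rewrite fnd_set eqxx; move: xv; rewrite -zx (in_fnd ze).
      by case=> ->.
    rewrite fnd_set fnd_rem1 zx; case: eqP => [zy|_].
      by move: ye; rewrite -zy ze.
    have ze' : z \in domf (rename_env y x e) by [].
    by rewrite (in_fnd ze') ffunE; congr (Some (rename _ _ (e _))); exact: val_inj.
  apply: RR => [|w]; first exact: (yv [` ze]).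
  exact: fve (in_fnd ze).
- exists (fun z z' => z = z' /\ reachable M e z); last first.
    by apply: aeq_refl => z zM; split=> //; constructor.
  move=> z _ [<- zr].
  have ze : z \in domf e.
    by case: zr => [x /fvM|x y v _ yv]; [|exact: fve yv].
  exists e.[ze], e.[ze]; split; rewrite ?(in_fnd ze) //.
    rewrite fnd_rem; case: ifP => [/Sr|_] //; exact: in_fnd.
  apply: aeq_refl => w wv; split=> //.
  exact: reach_env zr (in_fnd ze) wv.
Qed.

Lemma capsule_eq_bisim (c d : capsule) :
  capsule_eq c d -> bisim (cterm c) (cenv c) (cterm d) (cenv d).
Proof.
elim=> {c d} [c d|c|c d _|c d f _ cd _]; first exact: conv_step_bisim.
- exact: bisim_refl.
- exact: bisim_sym.
- exact: bisim_trans.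
Qed.

Lemma reduced_capsule_eq (c d : capsule) : capsule_eq c d -> reduced c = reduced d.
Proof.
elim=> {c d} [c d|//|//|c d f _ -> _ //]; rewrite /reduced.
have alpha M N : alpha_step M N -> is_lam M = is_lam N by case.
by case=> // [M M' _ /alpha|[] ].
Qed.

(** * Determinism *)

(** This excludes that one trace stops while the other tosses again, and that the two toss next at
    different positions; either would prevent a single tree from describing both. *)
Inductive fork : tosses -> tosses -> Prop :=
| fork_here i b l l' : fork ((i, b) :: l) ((i, ~~ b) :: l')
| fork_cons p l l' : fork l l' -> fork (p :: l) (p :: l').

Lemma fork_false i l l' : fork ((i, false) :: l) ((i, true) :: l').
Proof. exact: (fork_here i false). Qed.

Lemma fork_true i l l' : fork ((i, true) :: l) ((i, false) :: l').
Proof. exact: (fork_here i true). Qed.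

Lemma fork_reindex h l l' : fork l l' -> fork (reindex h l) (reindex h l').
Proof. by elim=> {l l'} [i b l l'|p l l' _]; [apply: fork_here|apply: fork_cons]. Qed.

Lemma fork_catl l1 l l' : fork l l' -> fork (l1 ++ l) (l1 ++ l').
Proof. by move=> ll'; elim: l1 => //= p l1; exact: fork_cons. Qed.

Lemma fork_catr l l' l1 l2 : fork l l' -> fork (l ++ l1) (l' ++ l2).
Proof. by elim=> {l l'} [i b l l'|p l l' _] /=; [apply: fork_here|apply: fork_cons]. Qed.

(** While the outcomes coincide the lists cannot have forked, so the marked tosses stand at the fork
    or before it, where positions agree. *)
Lemma fork_next p i b q p' j b' q' :
  fork (p ++ (i, b) :: q) (p' ++ (j, b') :: q') ->
  outcomes p = outcomes p' -> i = j.
Proof.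
elim: p p' => [|h p IH] [|h' p'] //= F; inversion F; subst=> //.
- by case=> /eqP; case: (b0).
- by case; exact: IH.
Qed.

(** Induction on the first trace, with the shape of the term dictating the second. [R'] must contain
    [R] because the argument of an application is matched by [R] but evaluated only after the
    function has changed the environments. *)
Lemma traced_det M e v f l M' e' v' f' l' R :
  traced M e v f l -> traced M' e' v' f' l' -> env_bisim R e e' -> aeq R M M' ->
  fork l l' \/
  l = l' /\ exists R' : nat -> nat -> Prop,
    [/\ forall x x', R x x' -> R' x x', env_bisim R' f f' & aeq R' v v'].
Proof.
move=> t; elim: t M' e' v' f' l' R => {M e v f l}
  [x e v ev|x M e|M N e v f l _ IH|M N e v f l _ IH|
   M N e x K e0 u e1 y v f l0 l1 l2 _ IH0 _ IH1 fy _ IH2]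
  M' e' v' f' l' R t' ee'.
- case: t' ee' => //= x' e1 w' ew' ee' /ee'[w [w1 [ew ew1 ww']]]; right.
  split=> //; exists R; split=> //.
  by move: ev ew' ww'; rewrite ew ew1 => -[<-] [<-].
- by case: t' ee' => //= x' M1 e1 ee' MM'; right; split=> //; exists R.
- case: t' ee' => //= M1 N1 e1 w g l1 t1 ee1 [MM' NN'].
    case: (IH _ _ _ _ _ _ t1 ee1 MM') => [F|[-> H]]; last by right.
    by left; apply/fork_cons/fork_reindex.
  by left; exact: fork_false.
- case: t' ee' => //= M1 N1 e1 w g l1 t1 ee1 [MM' NN'].
    by left; exact: fork_true.
  case: (IH _ _ _ _ _ _ t1 ee1 NN') => [F|[-> H]]; last by right.
  by left; apply/fork_cons/fork_reindex.
- case: t' ee' => //= {M' e' v' f' l'}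
    M' N' e' x' K' e0' u' e1' y' v' f' l0' l1' l2' t0 t1 fy' t2 ee' [MM' NN'].
  case: (IH0 _ _ _ _ _ _ t0 ee' MM') => [F|[-> [R0 [RR0 ee0 KK']]]].
    by left; apply/fork_catr/fork_reindex.
  case: (IH1 _ _ _ _ _ _ t1 ee0 (aeq_mono RR0 NN')) => [F|[-> [R1 [RR1 ee1 uu']]]].
    by left; apply/fork_catl/fork_catr/fork_reindex.
  case/and3P: fy => yKu ye1 _; case/and3P: fy' => yKu' ye1' _.
  (* The two fresh names are matched with each other. They lie outside the domains of [e1] and
     [e1'], so no binding of a pair already in [R1] is overwritten. *)
  pose R2 z z' := (z = y /\ z' = y') \/ R1 z z'.
  have RR2 z z' : R1 z z' -> R2 z z' by right.
  have ee2 : env_bisim R2 e1.[y <- u] e1'.[y' <- u'].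
    move=> z z' [[-> ->]|/ee1[w [w' [ew ew' ww']]]].
      by exists u, u'; rewrite !fnd_set !eqxx; split=> //; exact: aeq_mono uu'.
    exists w, w'; rewrite !fnd_set; split; last exact: aeq_mono ww'.
      by case: eqP => // zy; move: ye1; rewrite -zy (fnd_dom ew).
    by case: eqP => // zy; move: ye1'; rewrite -zy (fnd_dom ew').
  have KK2 : aeq R2 (rename y x K) (rename y' x' K').
    move: yKu yKu'; rewrite /= !inE !negb_or.
    move=> /andP[/andP[_ yK] _] /andP[/andP[_ yK'] _].
    apply: (aeq_rename (R := R0)) => //; first by left.
    by move=> z z' /RR1; exact: RR2.
  case: (IH2 _ _ _ _ _ _ t2 ee2 KK2) => [F|[-> [R3 [RR3 ff' vv']]]].
    by left; apply/fork_catl/fork_catl/fork_reindex.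
  by right; split=> //; exists R3; split=> // z z' /RR0/RR1/RR2/RR3.
Qed.

(** * The tree *)

Lemma proper_prefix_size (T : eqType) (x y : seq T) :
  prefix x y -> x <> y -> (size x < size y)%N.
Proof.
case/prefixP=> z -> xz; rewrite size_cat -addn1 leq_add2l lt0n size_eq0.
by apply/eqP => z0; apply: xz; rewrite z0 cats0.
Qed.

(** The representative is quantified too, since [big] and [small] may start from any of them and one
    tree must serve all. *)
Definition next_toss (c : capsule) (x : seq bool) (i : nat) : Prop :=
  exists c' v f p b q,
    [/\ capsule_eq c c', traced (cterm c') (cenv c') v f (p ++ (i, b) :: q)
      & outcomes p = x].

Lemma next_toss_inj c x i j : next_toss c x i -> next_toss c x j -> i = j.
Proof.
move=> [c' [v [f [p [b [q [cc' t px]]]]]]] [d [w [g [r [b' [s [cd u rx]]]]]]].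
have pr : outcomes p = outcomes r by rewrite px.
have [R ee' MM'] := bisim_trans (bisim_sym (capsule_eq_bisim cc')) (capsule_eq_bisim cd).
have [F|[E _]] := traced_det t u ee' MM'; first exact: fork_next F pr.
(* Equal traces are cut after equally many tosses, so the entries at the cut coincide. *)
have /eqP := E; rewrite eqseq_cat.
  by case/andP=> _ /eqP[].
by move/(congr1 size): pr; rewrite !size_map.
Qed.

(** The toss after [x] is the entry at index [size x] of the trace that passes through [y], and
    positions in a trace do not repeat. *)
Lemma next_toss_prefix c x y i :
  prefix x y -> x <> y -> next_toss c y i -> exists2 j, next_toss c x j & i <> j.
Proof.
move=> pxy xy; have [z yE] := prefixP pxy; move=> [c' [v [f [p [b [q [cc' t py]]]]]]].
have zn := proper_prefix_size pxy xy.
have sp : size p = size y by rewrite -py size_map.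
(* The default [(0, false)] is never returned, as [size x] is less than [size p]. *)
have pE : p = take (size x) p ++ nth (0, false) p (size x) :: drop (size x).+1 p.
  by rewrite -drop_nth ?cat_take_drop ?sp.
case jE : (nth (0, false) p (size x)) pE => [j d] pE.
exists j.
  exists c', v, f, (take (size x) p), d, (drop (size x).+1 p ++ (i, b) :: q).
  split=> //; first by rewrite pE -catA in t.
  by rewrite /outcomes map_take -/(outcomes p) py yE take_size_cat.
move=> ij; have := traced_uniq t.
rewrite pE map_cat cat_uniq => /and3P[_ /hasPn/(_ i)].
rewrite /= inE eqxx => /(_ isT) /negP H _; apply: H.
by rewrite map_cat mem_cat /= ij inE eqxx orbT.
Qed.

Definition the_next_toss (c : capsule) (x : seq bool) : nat :=
  epsilon (inhabits 0) (next_toss c x).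

Lemma next_tossE c x i : next_toss c x i -> the_next_toss c x = i.
Proof.
move=> n; apply: next_toss_inj (n).
exact: (epsilon_spec (inhabits 0) (next_toss c x) (ex_intro _ i n)).
Qed.

(* In the last case no evaluation of c follows x: the maximum keeps the value
   apart from the tosses at the prefixes of x, and [size x] keeps it apart from
   the values of this same case at the prefixes of x. *)
Definition tree (c : capsule) (x : seq bool) : nat :=
  if excluded_middle_informative (exists i, next_toss c x i)
  then the_next_toss c x
  else (size x + \max_(k < (size x).+1) (the_next_toss c (take k x)).+1)%N.

Lemma treeE c x i : next_toss c x i -> tree c x = i.
Proof.
move=> n; rewrite /tree; case: excluded_middle_informative => [?|[]] /=; last by exists i.
exact: next_tossE.
Qed.

Lemma coin_tree_tree c : coin_tree (tree c).
Proof.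
move=> x y pxy xy; rewrite {2}/tree.
case: excluded_middle_informative => [[i yi]|?] /=.
  have [j xj ij] := next_toss_prefix pxy xy yi.
  by rewrite (treeE xj) (next_tossE yi) => ji; apply: ij.
have [z yE] := prefixP pxy.
have xlt := proper_prefix_size pxy xy.
(* With no evaluation following [y], the value there is strictly larger. If [x] is followed by one,
   its toss enters the maximum at [k = size x]; otherwise the maximum at [x] is at most that at [y],
   and the size is strictly smaller. *)
apply/eqP; rewrite neq_ltn; apply/orP; left; rewrite /tree.
case: excluded_middle_informative => [?|?] /=.
  have xk : (size x < (size y).+1)%N by rewrite ltnS ltnW.
  apply: leq_trans (leq_addl _ _).
  have := leq_bigmax (F := fun k : 'I_(size y).+1 => (the_next_toss c (take k y)).+1)
    (Ordinal xk).
  by rewrite /= yE take_size_cat.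
rewrite -addSn leq_add //; apply/bigmax_leqP => k _.
have ky : (k < (size y).+1)%N by apply: leq_trans (ltn_ord k) _; rewrite ltnS ltnW.
have -> : take k x = take (Ordinal ky) y.
  by rewrite /= yE takel_cat // -ltnS ltn_ord.
exact: leq_bigmax.
Qed.

(** Each bit depends on all earlier ones, so the recursion builds the whole prefix. *)
Fixpoint tree_string (t : seq bool -> nat) (a : coins) (n : nat) : seq bool :=
  if n is m.+1 then rcons (tree_string t a m) (a (t (tree_string t a m))) else [::].

Definition process (t : seq bool -> nat) (a : coins) : coins :=
  fun n => a (t (tree_string t a n)).

Lemma mkseq_process t a n : mkseq (process t a) n = tree_string t a n.
Proof. by elim: n => //= n IH; rewrite mkseqS IH. Qed.

(** Induction on the last toss: once the earlier outcomes are the output so far, the next bit is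
    read at the position of that toss, and it is the recorded outcome exactly when the coin
    agrees. *)
Lemma agree_process t a l :
  (forall p i b q, l = p ++ (i, b) :: q -> t (outcomes p) = i) ->
  agree a l <-> finite_prefix (outcomes l) (process t a).
Proof.
rewrite /finite_prefix mkseq_process size_map.
elim/last_ind: l => [//|l [i b] IH] tl.
have {}IH : agree a l <-> outcomes l = tree_string t a (size l).
  by apply: IH => p j d q lE; apply: (tl p j d (rcons q (i, b))); rewrite lE rcons_cat.
have ti : t (outcomes l) = i by apply: (tl l i b [::]); rewrite cats1.
rewrite /agree all_rcons -/(agree a l) size_rcons /outcomes map_rcons -/(outcomes l) /=.
split=> [/andP[/eqP ai /IH lE]|/rcons_inj[lE bE]].
  by rewrite -lE ti ai.
by rewrite bE -lE ti eqxx; apply/IH.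
Qed.

Lemma agree_tree c c' a v f l :
  capsule_eq c c' -> traced (cterm c') (cenv c') v f l ->
  agree a l <-> finite_prefix (outcomes l) (process (tree c) a).
Proof.
move=> cc' t; apply: agree_process => p i b q lE; apply: treeE.
by exists c', v, f, p, b, q; split; rewrite // -lE.
Qed.

Theorem mainTheorem3 (c : capsule) :
  exists2 T : coins -> coins, tree_process T &
    forall (a : coins) (d : capsule),
      reduced d -> (big a c d <-> small_inf (T a) c d).
Proof.
exists (process (tree c)).
  exists (tree c); first exact: coin_tree_tree.
  by move=> a n; rewrite mkseq_process.
move=> a d rd; split.
- case=> c' [d' [cc' /big_raw_traced[l t al] dd']].
  exists (outcomes l); first exact/(agree_tree a cc' t).
  exists c', d'; split=> //; apply: traced_small t _; exact: capsule_lam_env.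
- case=> x xT [c' [d' [cc' s dd']]].
  (* Only a run that ends in a value yields a trace, and being reduced passes from [d] to its
     representative. *)
  have rd' : reduced d' by rewrite (reduced_capsule_eq dd').
  have [l t lx] := small_traced s (@capsule_lam_env c') rd'.
  exists c', d'; split=> //; apply/big_raw_traced; exists l => //.
  by apply/(agree_tree a cc' t); rewrite lx.
Qed.
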